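(* Let $\mathcal{G}_b=(\mathcal{A}_b\cup\mathcal{B}_b,\mathcal{E}_b)$ be a bipartite graph with edge weights $w:\mathcal{E}_b\to\mathbb{R}$, and let $\mathcal{M}$ be a maximum cardinality matching (MCM) of $\mathcal{G}_b$. If $\mathcal{M}$ is a solution to the Lexicographic Bottleneck Assignment Problem (LexBAP) for $\mathcal{G}_b$, then $\mathcal{M}$ is also a solution to the Sequential Bottleneck Assignment Problem (SeqBAP) for $\mathcal{G}_b$.
   Context: Setting: $\mathcal{G}_b=(\mathcal{V}_b,\mathcal{E}_b)$ is a finite undirected bipartite graph with $\mathcal{V}_b=\mathcal{A}_b\cup\mathcal{B}_b$, $\mathcal{A}_b\cap\mathcal{B}_b=\emptyset$, $\emptyset\neq\mathcal{E}_b\subseteq\{\{i,j\}\mid i\in\mathcal{A}_b,j\in\mathcal{B}_b\}$, and weights $w:\mathcal{E}_b\to\mathbb{R}$. A matching is a set of edges no two of which share a vertex; an MCM is a matching of maximum cardinality. $\mathcal{C}(\mathcal{G})$ is the set of MCMs of $\mathcal{G}$, $\mathcal{F}(\mathcal{G})$ is the cardinality of an MCM of $\mathcal{G}$, and $n=\mathcal{F}(\mathcal{G}_b)$. Ordered weights: for an MCM $\mathcal{M}$, $\mathcal{T}(\mathcal{M})=(\mathcal{T}_1(\mathcal{M}),\dots,\mathcal{T}_n(\mathcal{M}))$ is the tuple of weights of the edges of $\mathcal{M}$ arranged in non-increasing order. LexBAP: an MCM $\mathcal{M}$ is a solution if for every $\mathcal{M}'\in\mathcal{C}(\mathcal{G}_b)$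 with $\mathcal{T}(\mathcal{M}')\neq\mathcal{T}(\mathcal{M})$ there is $k\in\{1,\dots,n\}$ such that $\mathcal{T}_k(\mathcal{M})<\mathcal{T}_k(\mathcal{M}')$ and $\mathcal{T}_l(\mathcal{M})=\mathcal{T}_l(\mathcal{M}')$ for all positive integers $l<k$. Bottleneck weight: $\mathcal{W}(\mathcal{G})=\min_{\mathcal{M}\in\mathcal{C}(\mathcal{G})}\max_{e\in\mathcal{M}}w(e)$. Price of absence: for a graph $\mathcal{G}=(\mathcal{V},\mathcal{E})$ and $e\in\mathcal{E}$, $P(\mathcal{G},e)=\mathcal{W}((\mathcal{V},\mathcal{E}\setminus\{e\}))-\mathcal{W}((\mathcal{V},\mathcal{E}))$ if $\mathcal{F}((\mathcal{V},\mathcal{E}))=\mathcal{F}((\mathcal{V},\mathcal{E}\setminus\{e\}))$, and $P(\mathcal{G},e)=+\infty$ otherwise. For a set of edges $\mathcal{E}$, $\mathcal{L}(\mathcal{E})=\arg\max_{e\in\mathcal{E}}w(e)$ (the set of all maximisers). SeqBAP: an MCM $\mathcal{M}\in\mathcal{C}(\mathcal{G}_b)$ is a solution if its edges can be labelled $\{i_1,j_1\},\dots,\{i_n,j_n\}$ (with $i_k\in\mathcal{A}_b$, $j_k\in\mathcal{B}_b$) and there are matchings $\mathcal{M}^1,\dots,\mathcal{M}^n$ such that, with $\mathcal{A}^1=\mathcal{A}_b$, $\mathcal{B}^1=\mathcal{B}_b$, $\mathcal{A}^k=\mathcal{A}^{k-1}\setminus\{i_{k-1}\}$, $\mathcal{B}^k=\mathcal{B}^{k-1}\setminus\{j_{k-1}\}$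 for $2\le k\le n$, $\mathcal{E}^k=\{\{i,j\}\in\mathcal{E}_b\mid i\in\mathcal{A}^k,j\in\mathcal{B}^k\}$ and $\mathcal{G}^k=(\mathcal{A}^k\cup\mathcal{B}^k,\mathcal{E}^k)$, for every $k\in\{1,\dots,n\}$: $\mathcal{M}^k\in\arg\min_{\mathcal{M}'\in\mathcal{C}(\mathcal{G}^k)}\max_{e\in\mathcal{M}'}w(e)$ and $\{i_k,j_k\}\in\arg\max_{e\in\mathcal{L}(\mathcal{M}^k)}P(\mathcal{G}^k,e)$. *)

(* Defs.v *)
From HB Require Import structures.
From mathcomp Require Import all_boot all_order all_algebra.
From mathcomp Require Import reals constructive_ereal.

Set Implicit Arguments.
Unset Strict Implicit.
Unset Printing Implicit Defensive.

Import Order.TTheory GRing.Theory Num.Theory.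

Local Open Scope ring_scope.

Section ArgOpt.
Context {d : Order.disp_t} {X : porderType d} {T : finType}.

Definition argmax_set (f : T -> X) (S : {set T}) : {set T} :=
  [set x in S | [forall y in S, (f y <= f x)%O]].

Definition argmin_set (f : T -> X) (S : {set T}) : {set T} :=
  [set x in S | [forall y in S, (f x <= f y)%O]].

End ArgOpt.

(* An undirected edge {i, j} is the set [set i; j] of its endpoints. The vertex
   set is a subset of the ambient finite type V, so that vertices can be
   removed. *)
Record graph (V : finType) := Graph {
  vertices : {set V};
  edges : {set {set V}}
}.

Definition bipartite_edges (V : finType) (A B : {set V}) : {set {set V}} :=
  [set [set i; j] | i in A, j in B].

Section Matchings.
Variable V : finType.
Implicit Type G : graph V.

Definition matchings G : {set {set {set V}}} :=
  [set M : {set {set V}} | (M \subset edges G) && trivIset M].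

Definition mcms G : {set {set {set V}}} :=
  argmax_set (fun M : {set {set V}} => #|M|) (matchings G).

Definition mcm_size G : nat := (\max_(M in matchings G) #|M|)%N.

Definition del_edge G (e : {set V}) : graph V :=
  Graph (vertices G) (edges G :\ e).

End Matchings.

(* Weights are total functions on sets of vertices; only their values on the
   edges of the graph at hand are ever used. *)
Section Assignment.
Variables (R : realType) (V : finType) (w : {set V} -> R).
Implicit Types (G : graph V) (M : {set {set V}}) (A B : {set V}).

Definition ordered_weights M : seq R :=
  sort >=%R [seq w e | e <- enum M].

(* Positions are numbered from 0. *)
Definition LexBAP G M : Prop :=
  M \in mcms G /\
  forall M', M' \in mcms G -> ordered_weights M' <> ordered_weights M ->
    exists k : 'I_(mcm_size G),
      (ordered_weights M)`_k < (ordered_weights M')`_k /\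
      forall l : 'I_(mcm_size G), (l < k)%N ->
        (ordered_weights M)`_l = (ordered_weights M')`_l.

(* Extended reals make the maximum over an edge set total: it is -oo on the
   empty set, and the weight of an actual edge on any nonempty set. *)
Definition max_weight M : \bar R := \big[maxe/-oo%E]_(e in M) (w e)%:E.

Definition bottleneck G : \bar R := \big[mine/+oo%E]_(M in mcms G) max_weight M.

(* For an edge e of G whose deletion preserves mcm_size, the maximum matchings
   of both graphs are nonempty, so the difference is one of finite values. *)
Definition price_of_absence G (e : {set V}) : \bar R :=
  if mcm_size G == mcm_size (del_edge G e)
  then (bottleneck (del_edge G e) - bottleneck G)%E
  else +oo%E.

Definition heaviest M : {set {set V}} := argmax_set w M.

Fixpoint remaining A (x : nat -> V) (k : nat) : {set V} :=
  if k is k'.+1 then remaining A x k' :\ x k' else A.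

Definition bipartite_subgraph (E : {set {set V}}) A B : graph V :=
  Graph (A :|: B) [set e in E | e \in bipartite_edges A B].

(* Steps are numbered from 0; i, j and Ms matter only below mcm_size. As M has
   exactly mcm_size edges, the equation for M makes k |-> [set i k; j k] a
   bijection onto M. *)
Definition SeqBAP A B (E : {set {set V}}) M : Prop :=
  let G := Graph (A :|: B) E in
  M \in mcms G /\
  exists (i j : nat -> V) (Ms : nat -> {set {set V}}),
    let Gs k := bipartite_subgraph E (remaining A i k) (remaining B j k) in
    [/\ M = [set [set i k; j k] | k : 'I_(mcm_size G)],
        forall k, (k < mcm_size G)%N -> i k \in A /\ j k \in B &
        forall k, (k < mcm_size G)%N ->
          Ms k \in argmin_set max_weight (mcms (Gs k)) /\
          [set i k; j k] \in
            argmax_set (price_of_absence (Gs k)) (heaviest (Ms k))].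

End Assignment.

(* Main.v *)
(* A lexicographically optimal matching M is peeled by repeatedly deleting an
   edge of largest price of absence among the heaviest edges of what remains of
   M; the witness of SeqBAP at each step is the remaining part X of M itself.
   Let D be the set of deleted edges. They are at least as heavy as those of X,
   so the ordered weights of M are those of D followed by those of X. Every
   maximum matching X' of the remaining graph extends to the maximum matching
   D :|: X' of the whole graph; if all its edges were lighter than some edge of
   X, the ordered weights of D :|: X' would be those of D followed by those of
   X', and would precede those of M. Hence X is bottleneck optimal. *)
Require Import Defs.
From mathcomp Require Import all_boot all_order all_algebra.
From mathcomp Require Import reals constructive_ereal.

Set Implicit Arguments.
Unset Strict Implicit.
Unset Printing Implicit Defensive.

Import Order.TTheory.

Local Open Scope ring_scope.

Lemma argmax_set_neq0 (d : Order.disp_t) (X : orderType d) (T : finType)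
    (f : T -> X) (S : {set T}) : S != set0 -> exists x, x \in argmax_set f S.
Proof.
case/set0Pn=> x0 Sx0; case: (Order.TotalTheory.arg_maxP f Sx0) => x Sx max_x.
by exists x; rewrite inE; apply/andP; split; last exact/forall_inP.
Qed.

Section Peeling.
Variables (V : finType) (E : {set {set V}}).
Implicit Types (A B : {set V}) (D X M : {set {set V}}) (G : graph V).

(** * Matchings of the whole graph and of the remaining graph *)

Lemma mcmsP G M :
  reflect (M \in matchings G /\
           forall M', M' \in matchings G -> (#|M'| <= #|M|)%N)
          (M \in mcms G).
Proof.
rewrite [M \in mcms G]in_set.
by apply: (iffP andP) => -[mM maxM]; split=> //; exact/forall_inP.
Qed.

Lemma mcm_size_mcm G M : M \in mcms G -> mcm_size G = #|M|.
Proof.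
case/mcmsP=> mM maxM; apply/eqP; rewrite eqn_leq; apply/andP; split.
  exact/bigmax_leqP.
exact: leq_bigmax_cond.
Qed.

Lemma bipartite_edge_subset A B e :
  e \in bipartite_edges A B -> e != set0 /\ e \subset A :|: B.
Proof.
case/imset2P=> a b Aa Bb ->; split.
  by apply/set0Pn; exists a; rewrite set21.
by rewrite subUset !sub1set !inE Aa Bb orbT.
Qed.

(** Every edge of [X] lies in [A :|: B], which the edges of [D] avoid. An edge common to [D] and [X]
    would be disjoint from itself, hence empty, and bipartite edges are nonempty. *)
Lemma matching_setU U A B D X :
    D \in matchings (Graph U E) ->
    {in D, forall d : {set V}, [disjoint d & A :|: B]} ->
    X \in matchings (bipartite_subgraph E A B) ->
  [disjoint D & X] /\ D :|: X \in matchings (Graph U E).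
Proof.
rewrite 3!inE /= => /andP[sDE tD] dDAB /andP[/subsetP sXE tX].
have XE x : x \in X -> [/\ x \in E, x != set0 & x \subset A :|: B].
  by move/sXE; rewrite inE => /andP[Ex /bipartite_edge_subset[]].
have dDX d x : d \in D -> x \in X -> [disjoint d & x].
  move=> /dDAB dd /XE[_ _ sx].
  by rewrite disjoint_sym; apply: disjointWl sx _; rewrite disjoint_sym.
split.
  rewrite -setI_eq0; apply/eqP/setP=> e; rewrite !inE; apply/negP=> /andP[De Xe].
  have [_ e0 _] := XE _ Xe.
  by have := dDX _ _ De Xe; rewrite -setI_eq0 setIid (negPf e0).
rewrite subUset sDE; apply/andP; split.
  by apply/subsetP=> x /XE[].
move/trivIsetP: tD => tD; move/trivIsetP: tX => tX.
apply/trivIsetP=> e f /setUP[] He /setUP[] Hf nef.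
- exact: tD.
- exact: dDX.
- by rewrite disjoint_sym; apply: dDX.
- exact: tX.
Qed.

(** A matching of the remaining graph larger than [X] would, joined with [D], beat [D :|: X]. *)
Lemma residual_mcm U A B D X :
    D :|: X \in mcms (Graph U E) -> [disjoint D & X] ->
    {in D, forall d : {set V}, [disjoint d & A :|: B]} ->
    X \subset bipartite_edges A B ->
  X \in mcms (bipartite_subgraph E A B).
Proof.
case/mcmsP=> mDX maxDX dDX dD sX; move: (mDX).
rewrite inE /= subUset => /andP[/andP[sDE sXE] tDX].
have mD : D \in matchings (Graph U E).
  by rewrite inE sDE (trivIsetS _ tDX) ?subsetUl.
apply/mcmsP; split.
  rewrite inE (trivIsetS _ tDX) ?subsetUr // andbT.
  apply/subsetP=> x Xx; rewrite inE.
  by rewrite (subsetP sXE) // (subsetP sX).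
move=> X' mX'; have [dDX' mDX'] := matching_setU mD dD mX'.
have := maxDX _ mDX'.
rewrite !cardsU !disjoint_setI0 // cards0 !subn0.
by rewrite leq_add2l.
Qed.

Variables (R : realType) (w : {set V} -> R).


(** * Ordered weights *)

Lemma size_ordered_weights X : size (ordered_weights w X) = #|X|.
Proof. by rewrite size_sort size_map -cardE. Qed.

Lemma ordered_weightsP X a :
  reflect (exists2 x, x \in X & a = w x) (a \in ordered_weights w X).
Proof.
rewrite mem_sort; apply: (iffP mapP) => -[x].
  by rewrite mem_enum; exists x.
by move=> Xx ->; exists x; rewrite ?mem_enum.
Qed.

Lemma ordered_weights_sorted X : sorted >=%R (ordered_weights w X).
Proof. exact: (sort_sorted ge_total). Qed.

Lemma le_head_ordered_weights X x :
  x \in X -> w x <= (ordered_weights w X)`_0.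
Proof.
move=> Xx; have: w x \in ordered_weights w X by apply/ordered_weightsP; exists x.
have := ordered_weights_sorted X.
case: (ordered_weights w X) => [|a s] //= /(order_path_min ge_trans)/allP leas.
by rewrite in_cons => /predU1P[->|/leas].
Qed.

(** Both sides are sorted permutations of the same weights, and such a permutation is unique. *)
Lemma ordered_weights_setU D X :
    [disjoint D & X] -> {in D & X, forall d x, w x <= w d} ->
  ordered_weights w (D :|: X) = ordered_weights w D ++ ordered_weights w X.
Proof.
move=> dDX leXD; apply: (@sorted_eq _ >=%R).
- exact: ge_trans.
- exact: ge_anti.
- exact: ordered_weights_sorted.
- rewrite (sorted_pairwise ge_trans) pairwise_cat.
  rewrite -!(sorted_pairwise ge_trans) !ordered_weights_sorted !andbT.
  apply/allrelP=> a b /ordered_weightsP[d Dd ->] /ordered_weightsP[x Xx ->].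
  exact: leXD.
- apply: (@perm_trans _ ([seq w e | e <- enum D] ++ [seq w e | e <- enum X])).
    rewrite perm_sort -map_cat; apply/perm_map/uniq_perm; first exact: enum_uniq.
      rewrite cat_uniq !enum_uniq andbT; apply/hasPn=> e /=.
      by rewrite !mem_enum => Xe; rewrite (disjointFl dDX).
    by move=> e; rewrite mem_cat !mem_enum inE.
  by apply: perm_cat; rewrite perm_sym; apply/permEl/perm_sort.
Qed.

(** * Bottleneck optimality of the residual matching *)

Section LexOptimalResidual.
Variables (U A B : {set V}) (D X : {set {set V}}).
Hypothesis lexDX : LexBAP w (Graph U E) (D :|: X).
Hypothesis disjDX : [disjoint D & X].
Hypothesis disjD : {in D, forall d : {set V}, [disjoint d & A :|: B]}.
Hypothesis sX : X \subset bipartite_edges A B.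
Hypothesis leXD : {in D & X, forall d x, w x <= w d}.

Lemma residual_mcm_dominates X' x :
    X' \in mcms (bipartite_subgraph E A B) -> x \in X ->
  exists2 x', x' \in X' & w x <= w x'.
Proof.
move=> mcmX' Xx; apply/exists_inP; apply: contraT => /exists_inPn ltX'.
have {}ltX' x' : x' \in X' -> w x' < w x by move/ltX'; rewrite -ltNge.
case: lexDX => mcmDX optDX.
have mcmX := residual_mcm mcmDX disjDX disjD sX.
have cardX : #|X'| = #|X| by rewrite -(mcm_size_mcm mcmX) (mcm_size_mcm mcmX').
case/mcmsP: (mcmDX) => mDX maxDX.
have mD : D \in matchings (Graph U E).
  move: mDX; rewrite !inE subUset /= => /andP[/andP[-> _] tDX].
  by rewrite (trivIsetS _ tDX) ?subsetUl.
case/mcmsP: (mcmX') => mX' _.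
have [disjDX' mDX'] := matching_setU mD disjD mX'.
have mcmDX' : D :|: X' \in mcms (Graph U E).
  apply/mcmsP; split=> // N /maxDX.
  by rewrite !cardsU !disjoint_setI0 // cards0 cardX.
have leX'D : {in D & X', forall d x, w x <= w d}.
  by move=> d x' Dd /ltX'/ltW/le_trans; apply; apply: leXD.
(* [X'] has as many edges as [X], hence at least one, so entry 0 of its tuple is a true weight and
   not the default value. *)
have X'_gt0 : (0 < size (ordered_weights w X'))%N.
  by rewrite size_ordered_weights cardX; apply/card_gt0P; exists x.
have lt0 : (ordered_weights w X')`_0 < (ordered_weights w X)`_0.
  have /ordered_weightsP[x' X'x' ->] := mem_nth 0 X'_gt0.
  exact: lt_le_trans (ltX' _ X'x') (le_head_ordered_weights Xx).
move: (optDX _ mcmDX'); rewrite !ordered_weights_setU //.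
case=> [/eqP|k []].
  rewrite eqseq_cat // eqxx => /eqP eqX.
  by move: lt0; rewrite eqX ltxx.
have nthD Y l : (ordered_weights w D ++ ordered_weights w Y)`_l =
    if (l < #|D|)%N then (ordered_weights w D)`_l
    else (ordered_weights w Y)`_(l - #|D|).
  by rewrite nth_cat size_ordered_weights.
(* For [k] below [#|D|] both tuples agree, so the inequality is not strict; [k] beyond [#|D|] forces
   equal heads of [X] and [X']; [k] equal to [#|D|] reverses [lt0]. *)
rewrite !nthD; case: ltngtP => [_|Dk|->]; first by rewrite ltxx.
  move=> _ /(_ (Ordinal (ltn_trans Dk (ltn_ord k))) Dk) /=.
  by rewrite !nthD ltnn subnn => eq0; rewrite eq0 ltxx in lt0.
by rewrite subnn => /lt_trans/(_ lt0); rewrite ltxx.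
Qed.

Lemma residual_bottleneck_optimal :
  X \in argmin_set (max_weight w) (mcms (bipartite_subgraph E A B)).
Proof.
have [mcmDX _] := lexDX.
rewrite inE (residual_mcm mcmDX disjDX disjD sX) /=.
apply/forall_inP=> X' mcmX'; apply/bigmax_leP; split=> [|x Xx].
  exact: leNye.
have [x' X'x' lexx'] := residual_mcm_dominates mcmX' Xx.
apply: (@le_trans _ _ (w x')%:E); first by rewrite lee_fin.
exact: le_bigmax_cond.
Qed.

End LexOptimalResidual.

(** * Peeling by induction *)

Lemma remaining_shift A a (i : nat -> V) k :
  remaining A (fun l => if l is l'.+1 then i l' else a) k.+1 =
  remaining (A :\ a) i k.
Proof. by elim: k => //= k ->. Qed.

(** Induction on [#|X|]. Each step moves one edge from [X] to [D] and takes its endpoints out of [A]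
    and [B]; the union [D :|: X] never changes, so the lexicographic hypothesis is inherited as it
    stands. *)
Lemma peeling (x0 : V) U A B D X :
    [disjoint A & B] -> LexBAP w (Graph U E) (D :|: X) -> [disjoint D & X] ->
    {in D, forall d : {set V}, [disjoint d & A :|: B]} ->
    X \subset bipartite_edges A B ->
    {in D & X, forall d x, w x <= w d} ->
  exists (i j : nat -> V) (Ms : nat -> {set {set V}}),
    let Gs k := bipartite_subgraph E (remaining A i k) (remaining B j k) in
    [/\ X = [set [set i k; j k] | k : 'I_#|X|],
        forall k, (k < #|X|)%N -> i k \in A /\ j k \in B &
        forall k, (k < #|X|)%N ->
          Ms k \in argmin_set (max_weight w) (mcms (Gs k)) /\
          [set i k; j k] \in
            argmax_set (price_of_absence w (Gs k)) (heaviest w (Ms k))].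
Proof.
move Dn: #|X| => n; elim: n => [|n IHn] in A B D X Dn *
    => dAB lexDX dDX dD sX leXD.
  exists (fun=> x0), (fun=> x0), (fun=> set0); split=> //.
  rewrite (cards0_eq Dn); apply/esym/eqP; rewrite -subset0.
  by apply/subsetP=> e /imsetP[[]].
have X0 : X != set0 by rewrite -card_gt0 Dn.
have [e0 He0] := argmax_set_neq0 w X0.
have L0 : heaviest w X != set0 by apply/set0Pn; exists e0.
(* Being among the heaviest edges of [X], [e] can join [D] while [D] stays at least as heavy as the
   rest of [X]. *)
have [e He] := argmax_set_neq0 (price_of_absence w (bipartite_subgraph E A B)) L0.
have /andP[Xe /forall_inP maxe] : (e \in X) && [forall y in X, w y <= w e].
  by move: He; rewrite !inE => /andP[].
have /imset2P[a b Aa Bb eab] := subsetP sX _ Xe.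
have tDX : trivIset (D :|: X).
  by case: lexDX => /mcmsP[]; rewrite inE => /andP[].
have [] := IHn (A :\ a) (B :\ b) (e |: D) (X :\ e).
- by move: (cardsD1 e X); rewrite Xe Dn => -[].
- exact: disjointWl (subsetDl _ _) (disjointWr (subsetDl _ _) dAB).
- by rewrite -setUA [D :|: _]setUC setUA setD1K // setUC.
- rewrite -setI_eq0; apply/eqP/setP=> f; rewrite !inE.
  by case: eqP => //= _; apply/negP=> /andP[Df]; rewrite (disjointFr dDX).
(* Edges deleted earlier already avoid the larger sides; [e] avoids the smaller ones because [A] and
   [B] are disjoint. *)
- move=> d /setU1P[->|Dd]; last first.
    by apply: disjointWr (dD _ Dd); rewrite setUSS ?subsetDl.
  rewrite disjoint_sym eab -setI_eq0; apply/eqP/setP=> v; rewrite !inE.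
  apply/negP=> /andP[] /[swap] /orP[]/eqP->; rewrite eqxx /=.
    by rewrite (disjointFr dAB Aa) andbF.
  by rewrite (disjointFl dAB Bb) andbF orbF.
(* The other edges of [X] form a matching with [e], so they miss [a] and [b]. *)
- apply/subsetP=> f /setD1P[nfe Xf]; have /imset2P[c d Ac Bd fcd] := subsetP sX _ Xf.
  have dfe : [disjoint f & e].
    by move/trivIsetP: tDX; apply; rewrite ?inE ?Xf ?Xe ?orbT.
  have nce v : v \in f -> v != a /\ v != b.
    by move/(disjointFr dfe); rewrite eab !inE => /norP.
  rewrite fcd; apply/imset2P; exists c d => //; rewrite !inE.
    by rewrite Ac andbT; apply: (nce c _).1; rewrite fcd set21.
  by rewrite Bd andbT; apply: (nce d _).2; rewrite fcd set22.
- move=> d f /setU1P[->|Dd] /setD1P[_ Xf]; first exact: maxe.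
  exact: leXD.
move=> i [j [Ms [defX ijAB stepX]]].
(* The first deletion is put in front of the sequences from the induction hypothesis;
   [remaining_shift] identifies the later graphs. *)
exists (fun k => if k is k'.+1 then i k' else a),
  (fun k => if k is k'.+1 then j k' else b),
  (fun k => if k is k'.+1 then Ms k' else X); split.
- rewrite -(setD1K Xe) defX; apply/setP=> f; rewrite inE in_set1.
  apply/idP/imsetP => [/orP[/eqP->|/imsetP[k _ ->]]|[[[|k] ltk] _ ->]] /=.
  + by exists ord0.
  + by exists (lift ord0 k).
  + by rewrite eab eqxx.
  + by apply/orP; right; apply/imsetP; exists (Ordinal (ltk : (k < n)%N)).
- case=> [|k] // /(ijAB k).
  by case=> /setD1P[_ ?] /setD1P[].
- case=> [_|k /(stepX k)]; last by rewrite !remaining_shift.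
  split; first exact: residual_bottleneck_optimal lexDX dDX dD sX leXD.
  by rewrite -eab.
Qed.

End Peeling.

Theorem proposition4 (R : realType) (V : finType) (A B : {set V})
    (E : {set {set V}}) (w : {set V} -> R) (M : {set {set V}})
    (hAB : A :&: B = set0) (hE0 : E <> set0)
    (hE : E \subset bipartite_edges A B)
    (hM : M \in mcms (Graph (A :|: B) E)) :
  LexBAP w (Graph (A :|: B) E) M -> SeqBAP w A B E M.
Proof.
move=> lexM; split=> //.
(* The endpoint sequences are total functions, so a vertex is needed for their values past the last
   edge. *)
have [x0 _] : exists x0 : V, x0 \in A.
  move/eqP/set0Pn: hE0 => [e /(subsetP hE)/imset2P[a _ Aa _ _]].
  by exists a.
rewrite (mcm_size_mcm hM).
apply: (peeling (U := A :|: B) x0 (D := set0)); rewrite ?set0U //.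
- by rewrite -setI_eq0 hAB.
- by rewrite -setI_eq0 set0I.
- by move=> d; rewrite inE.
- case/mcmsP: hM => + _; rewrite inE => /andP[sME _].
  exact: subset_trans sME hE.
- by move=> d x; rewrite inE.
Qed.
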